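(* Work with the data of a deep hinge-loss Markov random field and its regularized linearly constrained quadratic program, as fixed in the context. For fixed inputs $\mathbf{x}_{sy},\mathbf{x}_{nn}$, write $\mathbf{g}(\mathbf{w}_{nn}) := \mathbf{g}_{nn}(\mathbf{x}_{nn},\mathbf{w}_{nn})$, $\mathbf{b}(\mathbf{w}_{nn}) := \mathbf{b}(\mathbf{x}_{sy},\mathbf{g}_{nn}(\mathbf{x}_{nn},\mathbf{w}_{nn}))$, let $$V(\mathbf{w}_{sy},\mathbf{b}) := \min_{\nu\in\mathbb{R}^{n_y+m}} \nu^T(\mathbf{D}(\mathbf{w}_{sy})+\epsilon \mathbf{I})\nu + \mathbf{c}(\mathbf{w}_{sy})^T\nu \quad\text{s.t.}\quad \mathbf{A}\nu+\mathbf{b}\le 0, \qquad (\ast)$$ and let $\mathbf{y}^*(\mathbf{w}_{sy},\mathbf{w}_{nn})$ be the target-variable part of the minimizer $\nu^*$ of $(\ast)$ with $\mathbf{b}=\mathbf{b}(\mathbf{w}_{nn})$. Suppose that for every $\mathbf{w}_{nn}\in\mathbb{R}^{n_g}$ the program $(\ast)$ with $\mathbf{b}=\mathbf{b}(\mathbf{w}_{nn})$ has a feasible solution. Suppose further that $\epsilon>0$, $\mathbf{w}_{sy}\in\mathbb{R}^r_{+}$ and $\mathbf{w}_{nn}\in\mathbb{R}^{n_g}$. Then: 1. $\mathbf{y}^*(\mathbf{w}_{sy},\mathbf{w}_{nn})$ is an $O(1/\epsilon)$-Lipschitz continuous function of $\mathbf{w}_{sy}$; that is, there is a constant $K$ independent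 of $\epsilon$ and of $\mathbf{w}_{sy}$ such that $\|\mathbf{y}^*(\mathbf{w}_{sy},\mathbf{w}_{nn})-\mathbf{y}^*(\mathbf{w}_{sy}',\mathbf{w}_{nn})\|_2\le \frac{K}{\epsilon}\|\mathbf{w}_{sy}-\mathbf{w}_{sy}'\|_2$ for all $\mathbf{w}_{sy},\mathbf{w}_{sy}'\in\mathbb{R}^r_+$. 2. $V(\mathbf{w}_{sy},\mathbf{b})$ is concave over $\mathbf{w}_{sy}$ and convex over $\mathbf{b}$. 3. $V(\mathbf{w}_{sy},\mathbf{b}(\mathbf{w}_{nn}))$ is differentiable with respect to $\mathbf{w}_{sy}$, with $$\nabla_{\mathbf{w}_{sy}}V(\mathbf{w}_{sy},\mathbf{b}(\mathbf{w}_{nn}))=\mathbf{\Phi}(\mathbf{y}^*(\mathbf{w}_{sy},\mathbf{w}_{nn}),\mathbf{x}_{sy},\mathbf{g}(\mathbf{w}_{nn})).$$ Furthermore, $\nabla_{\mathbf{w}_{sy}}V(\mathbf{w}_{sy},\mathbf{b}(\mathbf{w}_{nn}))$ is Lipschitz continuous over $\mathbf{w}_{sy}$. 4. If there is a feasible point $\nu$ strictly satisfying the $i$-th inequality constraint of $(\ast)$, i.e. $\mathbf{A}[i]\nu+\mathbf{b}(\mathbf{w}_{nn})[i]<0$, then $V$ is subdifferentiable with respect to the $i$-th constraint constant $\mathbf{b}[i]$ at $\mathbf{b}=\mathbf{b}(\mathbf{w}_{nn})$, and $$\partial_{\mathbf{b}[i]}V(\mathbf{w}_{sy},\mathbf{b}(\mathbf{w}_{nn}))=\Big\{\mu^*[i]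 \;\Big|\; \mu^*\in\operatorname*{arg\,min}_{\mu\in\mathbb{R}_{\ge0}^{2(n_y+m)+q}}h(\mu;\mathbf{w}_{sy},\mathbf{b}(\mathbf{w}_{nn}))\Big\}.$$ Furthermore, if $\mathbf{g}_{nn}(\mathbf{x}_{nn},\mathbf{w}_{nn})$ is a smooth function of $\mathbf{w}_{nn}$, then so is $\mathbf{b}(\mathbf{w}_{nn})$, and the set of regular subgradients of $\mathbf{w}_{nn}\mapsto V(\mathbf{w}_{sy},\mathbf{b}(\mathbf{w}_{nn}))$ satisfies $$\hat\partial_{\mathbf{w}_{nn}}V(\mathbf{w}_{sy},\mathbf{b}(\mathbf{w}_{nn}))\supset \nabla_{\mathbf{w}_{nn}}\mathbf{b}(\mathbf{w}_{nn})^T\,\partial_{\mathbf{b}}V(\mathbf{w}_{sy},\mathbf{b}(\mathbf{w}_{nn})).$$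
   Context: Data. Fix $n_y,n_x,n_g,m,r\ge 1$ and $q\ge 0$. The symbolic input is $\mathbf{x}_{sy}\in[0,1]^{n_x}$, the neural input is $\mathbf{x}_{nn}$, and the neural component is a function $\mathbf{w}_{nn}\mapsto \mathbf{g}_{nn}(\mathbf{x}_{nn},\mathbf{w}_{nn})\in[0,1]^{n_g}$ of neural weights $\mathbf{w}_{nn}\in\mathbb{R}^{n_g}$. The target variables are $\mathbf{y}\in[0,1]^{n_y}$. $\mathbb{R}^r_+$ denotes the vectors in $\mathbb{R}^r$ with nonnegative entries. Potentials. For $k=1,\dots,m$ let $$\ell_k(\mathbf{y})=\mathbf{a}_{\phi_k,\mathbf{y}}^T\mathbf{y}+\mathbf{a}_{\phi_k,\mathbf{x}_{sy}}^T\mathbf{x}_{sy}+\mathbf{a}_{\phi_k,\mathbf{g}_{nn}}^T\mathbf{g}_{nn}(\mathbf{x}_{nn},\mathbf{w}_{nn})+b_{\phi_k}$$ with given real coefficient vectors and constants, and $\phi_k(\mathbf{y},\mathbf{x}_{sy},\mathbf{g}_{nn}(\mathbf{x}_{nn},\mathbf{w}_{nn}))=(\max\{\ell_k(\mathbf{y}),0\})^{p_k}$ with $p_k\in\{1,2\}$. The index set $\{1,\dots,m\}$ is partitioned into $\tau_1,\dots,\tau_r$, where the exponent $p_k$ is the same for all $k$ in one part. Put $$\mathbf{\Phi}(\mathbf{y},\mathbf{x}_{sy},\mathbf{g}_{nn}(\mathbf{x}_{nn},\mathbf{w}_{nn}))=\Big[\sum_{k\in\tau_i}\phi_k(\mathbf{y},\mathbf{x}_{sy},\mathbf{g}_{nn}(\mathbf{x}_{nn},\mathbf{w}_{nn}))\Big]_{i=1}^r\in\mathbb{R}^r.$$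 The symbolic weights are $\mathbf{w}_{sy}\in\mathbb{R}^r_+$, one per part. Hard constraints. For $k=1,\dots,q$: $$\mathbf{a}_{c_k,\mathbf{y}}^T\mathbf{y}+\mathbf{a}_{c_k,\mathbf{x}_{sy}}^T\mathbf{x}_{sy}+\mathbf{a}_{c_k,\mathbf{g}_{nn}}^T\mathbf{g}_{nn}(\mathbf{x}_{nn},\mathbf{w}_{nn})+b_{c_k}\le 0,$$ with given real coefficient vectors and constants. Quadratic program. Introduce one slack variable $s_k$ per potential and collect all variables in $\nu=(\mathbf{s},\mathbf{y})\in\mathbb{R}^{n_y+m}$. The inference problem of minimizing $\mathbf{w}_{sy}^T\mathbf{\Phi}$ over $\mathbf{y}\in[0,1]^{n_y}$ satisfying the hard constraints is written as: minimize $\sum_{i}\mathbf{w}_{sy}[i]\sum_{k\in\tau_i}s_k^{p_k}$ subject to the $q$ hard constraints, $\ell_k(\mathbf{y})-s_k\le0$ and $-s_k\le 0$ for $k=1,\dots,m$, and $-y_j\le 0$, $y_j-1\le 0$ for $j=1,\dots,n_y$. All these $2(n_y+m)+q$ inequalities are written together as $\mathbf{A}\nu+\mathbf{b}(\mathbf{x}_{sy},\mathbf{g}_{nn}(\mathbf{x}_{nn},\mathbf{w}_{nn}))\le 0$, where $\mathbf{A}$ is a constant $(2(n_y+m)+q)\times(n_y+m)$ matrix and $\mathbf{b}(\mathbf{x}_{sy},\mathbf{g}_{nn}(\mathbf{x}_{nn},\mathbf{w}_{nn}))$ is the vector of constant terms, an affine function of $\mathbf{x}_{sy}$ and $\mathbf{g}_{nn}(\mathbf{x}_{nn},\mathbf{w}_{nn})$.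 The objective is $\nu^T\mathbf{D}(\mathbf{w}_{sy})\nu+\mathbf{c}(\mathbf{w}_{sy})^T\nu$, where $\mathbf{D}(\mathbf{w}_{sy})$ is the diagonal matrix whose entry at slack $s_k$ is $\mathbf{w}_{sy}[i]$ if $k\in\tau_i$ and $p_k=2$, and all other entries are $0$, and $\mathbf{c}(\mathbf{w}_{sy})$ is the vector whose entry at slack $s_k$ is $\mathbf{w}_{sy}[i]$ if $k\in\tau_i$ and $p_k=1$, and all other entries are $0$. Adding $\epsilon\mathbf{I}$ to $\mathbf{D}(\mathbf{w}_{sy})$ gives the regularized program. Conventions. In the value function $V(\mathbf{w}_{sy},\mathbf{b})$ the vector $\mathbf{b}$ is a free parameter in $\mathbb{R}^{2(n_y+m)+q}$, and $V=+\infty$ when the program is infeasible. At boundary points of $\mathbb{R}^r_+$, differentiability in $\mathbf{w}_{sy}$ refers to $V$ as defined by the same program formula for $\mathbf{w}_{sy}$ in a neighbourhood in $\mathbb{R}^r$. $\mathbf{A}[i]$ is the $i$-th row of $\mathbf{A}$ and $\mathbf{b}[i]$, $\mu[i]$ are $i$-th entries. Dual function. $$h(\mu;\mathbf{w}_{sy},\mathbf{b})=\tfrac14\mu^T\mathbf{A}(\mathbf{D}(\mathbf{w}_{sy})+\epsilon\mathbf{I})^{-1}\mathbf{A}^T\mu+\tfrac12\big(\mathbf{A}(\mathbf{D}(\mathbf{w}_{sy})+\epsilon\mathbf{I})^{-1}\mathbf{c}(\mathbf{w}_{sy})-2\mathbf{b}\big)^T\mu .$$ Subgradients. $\partial_{\mathbf{b}}V$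 is the usual convex subdifferential in $\mathbf{b}$, and $\partial_{\mathbf{b}[i]}V$ is the convex subdifferential with respect to the single entry $\mathbf{b}[i]$ with the others fixed. For $F:\mathbb{R}^n\to[-\infty,\infty]$ finite at $\bar{\mathbf{x}}$, a vector $\mathbf{v}$ is a regular subgradient, $\mathbf{v}\in\hat\partial F(\bar{\mathbf{x}})$, iff $F(\mathbf{x})\ge F(\bar{\mathbf{x}})+\langle\mathbf{v},\mathbf{x}-\bar{\mathbf{x}}\rangle+o(\|\mathbf{x}-\bar{\mathbf{x}}\|)$. ''Smooth'' means continuously differentiable, and $\nabla_{\mathbf{w}_{nn}}\mathbf{b}(\mathbf{w}_{nn})$ is the Jacobian of $\mathbf{b}(\mathbf{w}_{nn})$. *)

(* Defs.v *)
(* MathComp-Analysis development, over an arbitrary realType R.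
   All vectors are column vectors. *)
From HB Require Import structures.
From mathcomp Require Import all_boot all_order all_algebra.
From mathcomp Require Import all_classical all_reals all_analysis.

Set Implicit Arguments.
Unset Strict Implicit.
Unset Printing Implicit Defensive.

Import Order.TTheory GRing.Theory Num.Theory.
Import numFieldNormedType.Exports.

Local Open Scope classical_set_scope.
Local Open Scope ring_scope.

Section Vectors.
Variable R : realType.

Definition dotp (n : nat) (u v : 'cV[R]_n) : R := (u^T *m v) 0 0.

(* The norm `|v| that the library puts on matrices is the max norm. *)
Definition norm2 (n : nat) (v : 'cV[R]_n) : R :=
  Num.sqrt (\sum_i (v i 0) ^+ 2).

Definition nonneg (n : nat) : set 'cV[R]_n := [set v | forall i, 0 <= v i 0].

Definition unit_box (n : nat) : set 'cV[R]_n :=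
  [set v | forall i, 0 <= v i 0 <= 1].

End Vectors.
Arguments nonneg {R n}.
Arguments unit_box {R n}.

Section VariationalAnalysis.
Variables (R : realType) (n : nat).
Implicit Types F : 'cV[R]_n -> \bar R.

(* In both definitions below, 0 * (+oo) = 0 in \bar R, so the endpoints
   t = 0 and t = 1 impose nothing. *)
Definition econvex_on (C : set 'cV[R]_n) F : Prop :=
  forall x y, C x -> C y -> forall t : R, 0 <= t <= 1 ->
  (F (t *: x + (1 - t) *: y)%R
     <= t%:E * F x + (1 - t)%:E * F y)%E.

Definition econcave_on (C : set 'cV[R]_n) F : Prop :=
  forall x y, C x -> C y -> forall t : R, 0 <= t <= 1 ->
  (t%:E * F x + (1 - t)%:E * F y
     <= F (t *: x + (1 - t) *: y)%R)%E.

Definition subdiff F (x : 'cV[R]_n) : set 'cV[R]_n :=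
  [set v | F x \is a fin_num /\
     forall x', (F x + (dotp v (x' - x))%:E <= F x')%E].

Definition partial_subdiff F (i : 'I_n) (x : 'cV[R]_n) : set R :=
  [set v | F x \is a fin_num /\
     forall t : R, (F x + (v * t)%:E <= F (x + t *: delta_mx i 0)%R)%E].

Definition reg_subdiff F (x : 'cV[R]_n) : set 'cV[R]_n :=
  [set v | F x \is a fin_num /\
     forall e : R, 0 < e -> \forall x' \near x,
       (F x + (dotp v (x' - x) - e * norm2 (x' - x))%:E <= F x')%E].

Definition ediff F (x : 'cV[R]_n) : Prop :=
  (\forall x' \near x, F x' \is a fin_num) /\
  differentiable (fun x' => fine (F x') : R^o) x.

Definition egrad F (x : 'cV[R]_n) : 'cV[R]_n :=
  \col_i 'D_(delta_mx i 0) (fun x' => fine (F x') : R^o) x.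

(* Usual convention: row i of jac f x is the gradient of the i-th component
   (the library's jacobian is for maps of row vectors, and transposed). *)
Definition jac (p : nat) (f : 'cV[R]_n -> 'cV[R]_p) (x : 'cV[R]_n)
  : 'M[R]_(p, n) :=
  \matrix_(i, j) ('D_(delta_mx j 0) f x) i 0.

Definition smooth (p : nat) (f : 'cV[R]_n -> 'cV[R]_p) : Prop :=
  (forall x, differentiable f x) /\ continuous (jac f).

End VariationalAnalysis.

(* Row k of each coefficient matrix is the coefficient vector of potential
   (resp. hard constraint) k. *)
Record hlmrf (R : realType) (ny nx ng m q r : nat) := HLMRF {
  aphi_y : 'M[R]_(m, ny);
  aphi_x : 'M[R]_(m, nx);
  aphi_g : 'M[R]_(m, ng);
  bphi   : 'cV[R]_m;
  ac_y   : 'M[R]_(q, ny);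
  ac_x   : 'M[R]_(q, nx);
  ac_g   : 'M[R]_(q, ng);
  bc     : 'cV[R]_q;
  pexp   : 'I_m -> nat;
  tau    : 'I_r -> {set 'I_m};
  pexp12 : forall k, pexp k = 1%N \/ pexp k = 2%N;
  tau_partition : finset.partition [set tau i | i : 'I_r]%SET [set: 'I_m]%SET;
  tau_inj : injective tau;
  tau_pexp : forall i k l, k \in tau i -> l \in tau i -> pexp k = pexp l
}.

Section Program.
Variables (R : realType) (ny nx ng m q r : nat) (P : hlmrf R ny nx ng m q r).

Definition ell (x : 'cV[R]_nx) (g : 'cV[R]_ng) (y : 'cV[R]_ny) : 'cV[R]_m :=
  aphi_y P *m y + aphi_x P *m x + aphi_g P *m g + bphi P.

Definition phi (y : 'cV[R]_ny) (x : 'cV[R]_nx) (g : 'cV[R]_ng) (k : 'I_m) : R :=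
  Num.max (ell x g y k 0) 0 ^+ pexp P k.

Definition Phi (y : 'cV[R]_ny) (x : 'cV[R]_nx) (g : 'cV[R]_ng) : 'cV[R]_r :=
  \col_i \sum_(k in tau P i) phi y x g k.

(* The number 2 (ny + m) + q of inequalities; in order: hard constraints,
   ell_k(y) - s_k <= 0, - s_k <= 0, - y_j <= 0, y_j - 1 <= 0. *)
Definition num_ineq : nat := q + ((m + m) + (ny + ny)).

(* The variable is nu = col_mx s y. *)
Definition Amx : 'M[R]_(num_ineq, m + ny) :=
  col_mx (row_mx 0 (ac_y P))
    (col_mx (col_mx (row_mx (- 1%:M) (aphi_y P))
                    (row_mx (- 1%:M) 0))
            (col_mx (row_mx 0 (- 1%:M))
                    (row_mx 0 1%:M))).

Definition bvec (x : 'cV[R]_nx) (g : 'cV[R]_ng) : 'cV[R]_num_ineq :=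
  col_mx (ac_x P *m x + ac_g P *m g + bc P)
    (col_mx (col_mx (aphi_x P *m x + aphi_g P *m g + bphi P) 0)
            (col_mx 0 (const_mx (- 1)))).

(* The sum has exactly one term: the part containing k. *)
Definition part_weight (w : 'cV[R]_r) (k : 'I_m) : R :=
  \sum_(i | k \in tau P i) w i 0.

Definition Dmx (w : 'cV[R]_r) : 'M[R]_(m + ny) :=
  diag_mx (row_mx (\row_k (if pexp P k == 2%N then part_weight w k else 0)) 0).

Definition cvec (w : 'cV[R]_r) : 'cV[R]_(m + ny) :=
  col_mx (\col_k (if pexp P k == 1%N then part_weight w k else 0)) 0.

Definition objective (eps : R) (w : 'cV[R]_r) (nu : 'cV[R]_(m + ny)) : R :=
  dotp nu ((Dmx w + eps%:M) *m nu) + dotp (cvec w) nu.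

Definition feasible (b : 'cV[R]_num_ineq) : set 'cV[R]_(m + ny) :=
  [set nu | forall i, (Amx *m nu + b) i 0 <= 0].

Definition minimizer (eps : R) (w : 'cV[R]_r) (b : 'cV[R]_num_ineq)
  : set 'cV[R]_(m + ny) :=
  [set nu | feasible b nu /\
     forall nu', feasible b nu' -> objective eps w nu <= objective eps w nu'].

(* Defined for every w, of any sign; the infimum of the empty set is +oo. *)
Definition V (eps : R) (w : 'cV[R]_r) (b : 'cV[R]_num_ineq) : \bar R :=
  ereal_inf [set (objective eps w nu)%:E | nu in feasible b].

(* Junk unless the program has a minimizer. *)
Definition ystar (eps : R) (w : 'cV[R]_r) (b : 'cV[R]_num_ineq) : 'cV[R]_ny :=
  dsubmx (xget 0 (minimizer eps w b)).

Definition hdual (eps : R) (w : 'cV[R]_r) (b mu : 'cV[R]_num_ineq) : R :=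
  4^-1 * dotp mu (Amx *m invmx (Dmx w + eps%:M) *m Amx^T *m mu) +
  2^-1 * dotp (Amx *m invmx (Dmx w + eps%:M) *m cvec w - 2 *: b) mu.

Definition dual_argmin (eps : R) (w : 'cV[R]_r) (b : 'cV[R]_num_ineq)
  : set 'cV[R]_num_ineq :=
  [set mu | nonneg mu /\
     forall mu', nonneg mu' -> hdual eps w b mu <= hdual eps w b mu'].

End Program.

(* Main.v *)
(** The objective is affine in the symbolic weights, namely
    [<w, S(nu)> + eps |nu|^2] with [S] the vector of sums of slack powers, and
    for nonnegative [w] it is [eps]-strongly convex in [nu]; hence it grows at
    least like [eps |nu' - nu|^2] around the minimizer [nu]. Monotonicity in the
    slacks gives [s_k = max (ell_k y, 0)] at the minimizer, so [S(nu) = Phi] and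
    minimizers are bounded independently of [eps] and [w].
    Adding the growth inequalities of two minimizers gives the [O(1/eps)]
    Lipschitz bound, and growth against the perturbation [<w' - w, S>] gives
    [V(w') = V(w) + <w' - w, S(nu)> + O(|w' - w|^2)].
    For the constraint constants, a subgradient [v] in the entry [b[i]] is a
    multiplier of the quadratic program in which [b[i]] itself is a variable of
    cost [- v]. Since all constraints are affine, Farkas' lemma provides KKT
    multipliers without a constraint qualification, and these are the
    minimizers of the dual function. *)
Require Import Defs.
From HB Require Import structures.
From mathcomp Require Import all_boot all_order all_algebra.
From mathcomp Require Import all_classical all_reals all_analysis.
From mathcomp Require Import ring lra.
Set Implicit Arguments.
Unset Strict Implicit.
Unset Printing Implicit Defensive.
Import Order.TTheory GRing.Theory Num.Theory.
Import numFieldNormedType.Exports.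
Local Open Scope classical_set_scope.
Local Open Scope ring_scope.

(** * The inner product of column vectors *)

Section Dotp.
Variables (R : realType) (n : nat).
Implicit Types (u v w : 'cV[R]_n) (a : R).

Lemma dotpE u v : dotp u v = \sum_i u i 0 * v i 0.
Proof. by rewrite /dotp mxE; apply: eq_bigr => i _; rewrite mxE. Qed.

Lemma dotpC u v : dotp u v = dotp v u.
Proof. by rewrite !dotpE; apply: eq_bigr => i _; rewrite mulrC. Qed.

Lemma dotpDl u v w : dotp (u + v) w = dotp u w + dotp v w.
Proof. by rewrite /dotp linearD mulmxDl mxE. Qed.

Lemma dotpDr u v w : dotp u (v + w) = dotp u v + dotp u w.
Proof. by rewrite /dotp mulmxDr mxE. Qed.

Lemma dotpZl a u v : dotp (a *: u) v = a * dotp u v.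
Proof. by rewrite /dotp linearZ -scalemxAl mxE. Qed.

Lemma dotpZr a u v : dotp u (a *: v) = a * dotp u v.
Proof. by rewrite /dotp -scalemxAr mxE. Qed.

Lemma dotpNl u v : dotp (- u) v = - dotp u v.
Proof. by rewrite -scaleN1r dotpZl mulN1r. Qed.

Lemma dotpNr u v : dotp u (- v) = - dotp u v.
Proof. by rewrite -scaleN1r dotpZr mulN1r. Qed.

Lemma dotpBl u v w : dotp (u - v) w = dotp u w - dotp v w.
Proof. by rewrite dotpDl dotpNl. Qed.

Lemma dotpBr u v w : dotp u (v - w) = dotp u v - dotp u w.
Proof. by rewrite dotpDr dotpNr. Qed.

Lemma dotp0l v : dotp 0 v = 0.
Proof. by rewrite -(scale0r 0) dotpZl mul0r. Qed.

Lemma dotp0r v : dotp v 0 = 0.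
Proof. by rewrite dotpC dotp0l. Qed.

Lemma dotp_suml (I : Type) (r : seq I) (P : pred I) (F : I -> 'cV[R]_n) v :
  dotp (\sum_(i <- r | P i) F i) v = \sum_(i <- r | P i) dotp (F i) v.
Proof.
elim/big_rec2: _ => [|i x y _ <-]; first exact: dotp0l.
exact: dotpDl.
Qed.

Lemma dotp_delta u i : dotp u (delta_mx i 0) = u i 0.
Proof.
rewrite dotpE (bigD1 i)//= big1 ?mxE ?eqxx ?mulr1 ?addr0// => j ji.
by rewrite mxE (negPf ji) mulr0.
Qed.

Lemma dotp_ge0 u : 0 <= dotp u u.
Proof. by rewrite dotpE; apply: sumr_ge0 => i _; rewrite -expr2 sqr_ge0. Qed.

Lemma dotp_eq0 u : dotp u u = 0 -> u = 0.
Proof.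
rewrite dotpE => /eqP; rewrite psumr_eq0 => [/allP u0|i _]; last first.
  by rewrite -expr2 sqr_ge0.
apply/matrixP => i j; rewrite ord1 mxE; apply/eqP.
by have := u0 i (mem_index_enum i); rewrite /= mulf_eq0 orbb.
Qed.

Lemma dotp_ext u v : (forall x, dotp u x = dotp v x) -> u = v.
Proof. by move=> uv; apply/matrixP => i j; rewrite ord1 -!dotp_delta uv. Qed.

End Dotp.

Lemma dotp_mulmx (R : realType) (p n : nat) (A : 'M[R]_(p, n)) u v :
  dotp u (A *m v) = dotp (A^T *m u) v.
Proof. by rewrite /dotp trmx_mul trmxK mulmxA. Qed.

Lemma dotp_col_mx (R : realType) (p n : nat) (u u' : 'cV[R]_p) (v v' : 'cV[R]_n) :
  dotp (col_mx u v) (col_mx u' v') = dotp u u' + dotp v v'.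
Proof. by rewrite /dotp tr_col_mx mul_row_col mxE. Qed.

(** * Farkas' lemma for finitely many linear inequalities *)

Section Farkas.
Variables (R : realType) (n : nat).

(* Bartl's induction: if the first [p] inequalities do not suffice, some [z]
   violating [c] has [dotp (a p) z = 1], and projecting along [z] onto the
   kernel of [a p] removes the last inequality. *)
Lemma farkas_seq p (a : nat -> 'cV[R]_n) (c : 'cV[R]_n) :
  (forall x, (forall j, (j < p)%N -> dotp (a j) x <= 0) -> dotp c x <= 0) ->
  exists2 l : nat -> R, (forall j, 0 <= l j) & c = \sum_(j < p) l j *: a j.
Proof.
elim: p => [|p IHp] in a c *.
  move=> c_le0; exists (fun=> 0) => //; rewrite big_ord0.
  by apply: dotp_eq0; apply/le_anti/andP; split; [exact: c_le0 | exact: dotp_ge0].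
move=> c_le0.
have [[x [ax cx]]|nx] := pselect (exists x,
    (forall j, (j < p)%N -> dotp (a j) x <= 0) /\ 0 < dotp c x); last first.
  have [x xa|l l0 cE] := IHp a c.
    by rewrite leNgt; apply/negP => cx; apply: nx; exists x.
  exists (fun j => if (j < p)%N then l j else 0) => [j|]; first by case: ifP.
  rewrite big_ord_recr/= ltnn scale0r addr0 cE.
  by apply: eq_bigr => j _; rewrite ltn_ord.
have apx : 0 < dotp (a p) x.
  rewrite ltNge; apply/negP => apx.
  suff : dotp c x <= 0 by rewrite leNgt cx.
  by apply: c_le0 => j; rewrite ltnS leq_eqVlt => /predU1P[->|/ax].
pose z := (dotp (a p) x)^-1 *: x.
have apz : dotp (a p) z = 1 by rewrite dotpZr mulVf// gt_eqF.
have az j : (j < p)%N -> dotp (a j) z <= 0.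
  by move=> /ax ajx; rewrite dotpZr pmulr_rle0// invr_gt0.
have cz : 0 < dotp c z by rewrite dotpZr mulr_gt0// invr_gt0.
clearbody z.
have projE (u y : 'cV[R]_n) :
    dotp (u - dotp u z *: a p) y = dotp u (y - dotp (a p) y *: z).
  by rewrite dotpBl dotpBr dotpZl dotpZr mulrC.
have [y ya|l l0 cE] := IHp (fun j => a j - dotp (a j) z *: a p) (c - dotp c z *: a p).
  rewrite projE; apply: c_le0 => j; rewrite ltnS leq_eqVlt => /predU1P[->|/ya].
    by rewrite dotpBr dotpZr apz mulr1 subrr.
  by rewrite projE.
exists (fun j => if (j < p)%N then l j else
    dotp c z - \sum_(j < p) l j * dotp (a j) z) => [j|].
  case: ifP => // _; rewrite subr_ge0 (le_trans _ (ltW cz))//.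
  by apply: sumr_le0 => i _; rewrite mulr_ge0_le0// az.
rewrite big_ord_recr/= ltnn (eq_bigr (fun j : 'I_p => l j *: a j)); last first.
  by move=> j _; rewrite ltn_ord.
apply/eqP; rewrite scalerBl addrCA addrC -subr_eq cE; apply/eqP.
by rewrite scaler_suml -sumrB; apply: eq_bigr => j _; rewrite scalerBr scalerA.
Qed.

Lemma farkas p (A : 'M[R]_(p, n)) (c : 'cV[R]_n) :
  (forall x, (forall j, (A *m x) j 0 <= 0) -> dotp c x <= 0) ->
  exists2 l : 'cV[R]_p, nonneg l & c = A^T *m l.
Proof.
move=> c_le0.
(* The rows are continued by zero to a sequence over [nat], the form on which the induction runs. *)
pose a j : 'cV[R]_n := if insub j is Some i then (row i A)^T else 0.
have aE (j : 'I_p) : a j = (row j A)^T by rewrite /a valK.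
have dE (j : 'I_p) x : dotp (a j) x = (A *m x) j 0.
  by rewrite aE /dotp trmxK -row_mul mxE.
have [x xa|l l0 cE] := @farkas_seq p a c.
  by apply: c_le0 => j; rewrite -dE; exact: xa.
exists (\col_j l j) => [j|]; first by rewrite mxE.
apply: dotp_ext => x; rewrite cE dotp_suml -dotp_mulmx dotpE.
by apply: eq_bigr => j _; rewrite dotpZl dE mxE.
Qed.

End Farkas.

(** * Comparison of the max norm, the inner product and the Euclidean norm *)

Section Norms.
Variables (R : realType) (n : nat).
Implicit Types u v : 'cV[R]_n.

Lemma coord_le_norm p (X : 'M[R]_(n, p)) i j : `|X i j| <= `|X|.
Proof.
by rewrite [leRHS]/Num.Def.normr/= mx_normrE; exact: (le_bigmax _ _ (i, j)).
Qed.

Lemma mx_norm_le p (X : 'M[R]_(n, p)) (c : R) : 0 <= c ->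
  (forall i j, `|X i j| <= c) -> `|X| <= c.
Proof.
move=> c0 Xc; rewrite [leLHS]/Num.Def.normr/= mx_normrE.
by apply: bigmax_le => //= -[i j] _ /=.
Qed.

Lemma norm_le_coord u (c : R) : 0 <= c -> (forall i, `|u i 0| <= c) -> `|u| <= c.
Proof. by move=> c0 uc; apply: mx_norm_le => // i j; rewrite ord1. Qed.

Lemma sqr_norm_le_dotp u : `|u| ^+ 2 <= dotp u u.
Proof.
rewrite -[leRHS]sqr_sqrtr ?dotp_ge0// lerXn2r ?nnegrE ?sqrtr_ge0//.
apply: norm_le_coord => [|i]; first exact: sqrtr_ge0.
rewrite -sqrtr_sqr ler_wsqrtr// dotpE (bigD1 i)//= expr2 lerDl.
by apply: sumr_ge0 => j _; rewrite -expr2 sqr_ge0.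
Qed.

Lemma norm_dotp_le u v : `|dotp u v| <= n%:R * `|u| * `|v|.
Proof.
rewrite dotpE (le_trans (ler_norm_sum _ _ _))//.
rewrite (@le_trans _ _ (\sum_(i < n) `|u| * `|v|))//.
  by apply: ler_sum => i _; rewrite normrM ler_pM ?coord_le_norm.
by rewrite sumr_const card_ord -mulrA mulr_natl.
Qed.

Lemma norm2E u : norm2 u = Num.sqrt (dotp u u).
Proof. by rewrite /norm2 dotpE; under eq_bigr do rewrite expr2. Qed.

Lemma norm_le_norm2 u : `|u| <= norm2 u.
Proof.
rewrite norm2E -[leLHS]ger0_norm// -sqrtr_sqr.
by rewrite ler_wsqrtr// sqr_norm_le_dotp.
Qed.

Lemma norm2_le_norm u : norm2 u <= n%:R * `|u|.
Proof.
rewrite norm2E -[leRHS]ger0_norm ?mulr_ge0// -sqrtr_sqr ler_wsqrtr//.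
rewrite (le_trans (ler_norm _))// (le_trans (norm_dotp_le _ _))//.
rewrite exprMn -mulrA -expr2 ler_wpM2r ?sqr_ge0// -natrX ler_nat.
by case: n => // k; rewrite leq_pmulr.
Qed.

End Norms.

(** * Quadratic programs: growth at a minimizer and KKT multipliers *)

Section QP.
Variable R : realType.

Definition qobj n (M : 'M[R]_n) (c nu : 'cV[R]_n) : R :=
  dotp nu (M *m nu) + dotp c nu.

Definition qfeasible n p (A : 'M[R]_(p, n)) (b : 'cV[R]_p) : set 'cV[R]_n :=
  [set nu | forall i, (A *m nu + b) i 0 <= 0].

Definition qmin n p (M : 'M[R]_n) c (A : 'M[R]_(p, n)) b : set 'cV[R]_n :=
  [set nu | qfeasible A b nu /\
     forall nu', qfeasible A b nu' -> qobj M c nu <= qobj M c nu'].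

(** For positive definite [M], the negated Lagrange dual function up to a constant free of [b] and
    [mu]. *)
Definition qdual n p (M : 'M[R]_n) c (A : 'M[R]_(p, n)) b mu : R :=
  4^-1 * dotp mu (A *m invmx M *m A^T *m mu) +
  2^-1 * dotp (A *m invmx M *m c - 2 *: b) mu.

(** Extracts a first-order condition from minimality along a segment: for small [t] the quadratic
    term cannot compensate a negative slope. *)
Lemma slope_ge0 (al be T : R) : 0 < T ->
  (forall t, 0 < t <= T -> 0 <= t * al + t ^+ 2 * be) -> 0 <= al.
Proof.
move=> T0 tP; rewrite leNgt; apply/negP => al0.
(* With this [K], a step [t <= - al / K] gives [t * be <= - al / 2], so that [al + t * be] is
   negative. *)
pose K := 2 * (`|be| + 1).
have K0 : 0 < K by rewrite mulr_gt0// ltr_wpDl.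
pose t := Num.min T (- al / K).
have t0 : 0 < t by rewrite lt_min T0/= divr_gt0// oppr_gt0.
have /tP : 0 < t <= T by rewrite t0 ge_min lexx.
have tK : t * K <= - al by rewrite -ler_pdivlMr// ge_min lexx orbT.
rewrite expr2 -mulrA -mulrDr pmulr_rge0// leNgt => /negP; apply.
have := ler_norm be => bel.
have : t * be <= t * `|be| by rewrite ler_wpM2l// ltW.
by move: tK t0 al0; rewrite /K; lra.
Qed.

Section Fixed.
Variables (n p : nat) (M : 'M[R]_n) (c : 'cV[R]_n) (A : 'M[R]_(p, n)).
Hypothesis Msym : M^T = M.
Implicit Types (b mu : 'cV[R]_p) (nu d : 'cV[R]_n).

Lemma dotp_symC nu d : dotp d (M *m nu) = dotp nu (M *m d).
Proof. by rewrite dotp_mulmx Msym dotpC. Qed.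

Lemma qobj_line nu d t : qobj M c (nu + t *: d) =
  qobj M c nu + (t * dotp (2 *: (M *m nu) + c) d + t ^+ 2 * dotp d (M *m d)).
Proof.
rewrite /qobj mulmxDr -scalemxAr !(dotpDl, dotpDr, dotpZl, dotpZr).
rewrite (dotp_symC d nu) (dotpC (M *m nu)) (dotp_symC nu d); ring.
Qed.

(** Equal constants give convexity of the feasible set; distinct ones are what convexity of the
    value function in [b] requires. *)
Lemma qfeasible_convex b b' nu nu' t : 0 <= t <= 1 ->
  qfeasible A b nu -> qfeasible A b' nu' ->
  qfeasible A (t *: b + (1 - t) *: b') (t *: nu + (1 - t) *: nu').
Proof.
move=> /andP[t0 t1] fnu fnu' i.
have -> : A *m (t *: nu + (1 - t) *: nu') + (t *: b + (1 - t) *: b') =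
    t *: (A *m nu + b) + (1 - t) *: (A *m nu' + b').
  by rewrite mulmxDr -!scalemxAr !scalerDr addrACA.
have := fnu i; have := fnu' i; rewrite !mxE => h h'.
rewrite -[leRHS](addr0 0); apply: lerD; apply: mulr_ge0_le0 => //.
by rewrite subr_ge0.
Qed.

(** The segment to [nu'] is feasible, so the slope at [nu] towards [nu'] is nonnegative, and the
    exact expansion of the objective leaves the quadratic term. *)
Lemma qmin_strong b nu nu' : qmin M c A b nu -> qfeasible A b nu' ->
  qobj M c nu + dotp (nu' - nu) (M *m (nu' - nu)) <= qobj M c nu'.
Proof.
move=> [fnu mnu] fnu'.
have -> : qobj M c nu' = qobj M c (nu + 1 *: (nu' - nu)).
  by rewrite scale1r addrC subrK.
rewrite qobj_line lerD2l expr1n !mul1r lerDr.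
apply: (@slope_ge0 _ (dotp (nu' - nu) (M *m (nu' - nu))) 1) => // t /andP[t0 t1].
rewrite -(lerD2l (qobj M c nu)) addr0 -qobj_line; apply: mnu.
have -> : nu + t *: (nu' - nu) = t *: nu' + (1 - t) *: nu.
  by rewrite scalerBr scalerBl scale1r addrCA addrC -addrA.
have -> : b = t *: b + (1 - t) *: b by rewrite -scalerDl subrKC scale1r.
by apply: qfeasible_convex => //; rewrite (ltW t0).
Qed.

(** A direction that raises no active constraint is feasible for a short step, so the gradient is
    nonnegative along it; Farkas' lemma then writes the negated gradient as a nonnegative
    combination of the active rows. *)
Lemma qmin_kkt b nu : qmin M c A b nu -> exists2 mu, nonneg mu &
  2 *: (M *m nu) + c + A^T *m mu = 0 /\ dotp mu (A *m nu + b) = 0.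
Proof.
move=> [fnu mnu]; pose act i := (A *m nu + b) i 0 == 0.
(* [E] zeroes the inactive rows, so that Farkas only sees feasible directions. *)
pose E : 'M[R]_p := diag_mx (\row_i (act i)%:R).
have Ediag (x : 'cV_p) j : (E *m x) j 0 = (act j)%:R * x j 0.
  by rewrite mul_diag_mx !mxE.
have ET : E^T = E by rewrite tr_diag_mx.
have [x xA|l l0 lE] := @farkas _ _ p (E *m A) (- (2 *: (M *m nu) + c)).
  rewrite dotpNl oppr_le0.
  (* Each constraint gets its own step length: an arbitrary one, here [1], if it is active, and
     otherwise its slack divided by a bound on its slope. *)
  have step j : exists T : R, 0 < T /\
      forall t, 0 < t <= T -> (A *m (nu + t *: x) + b) j 0 <= 0.
    have lineE t : (A *m (nu + t *: x) + b) j 0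
        = (A *m nu + b) j 0 + t * (A *m x) j 0.
      by rewrite mulmxDr -scalemxAr !mxE addrAC.
    have := fnu j; rewrite le_eqVlt => /orP[actj|Anu].
      exists 1; split=> // t /andP[t0 _]; rewrite lineE (eqP actj) add0r.
      have := xA j; rewrite -mulmxA Ediag /act actj mul1r => h.
      by rewrite pmulr_rle0.
    pose a := (A *m nu + b) j 0; rewrite -/a in Anu.
    have K0 : 0 < `|(A *m x) j 0| + 1 by rewrite ltr_wpDl.
    exists (- a / (`|(A *m x) j 0| + 1)); split=> [|t /andP[t0 tT]].
      by rewrite divr_gt0// oppr_gt0.
    rewrite lineE -/a; move: tT; rewrite ler_pdivlMr// => tT.
    have : t * (A *m x) j 0 <= t * `|(A *m x) j 0| by rewrite ler_pM2l// ler_norm.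
    by move: tT t0; lra.
  have [T TP] := choice step.
  (* The least of the finitely many step lengths serves all constraints; the default [1] keeps it
     positive when there are none. *)
  apply: (@slope_ge0 _ (dotp x (M *m x)) (\big[Num.min/1]_j T j)) => [|t].
    by apply: lt_bigmin => // j _; have [] := TP j.
  move=> /andP[t0 tT]; rewrite -(lerD2l (qobj M c nu)) addr0 -qobj_line.
  apply: mnu => j; have [_] := TP j; apply; rewrite t0 (le_trans tT)//.
  exact: bigmin_le.
exists (E *m l) => [j|].
  by rewrite Ediag mulr_ge0.
split; first by rewrite mulmxA -[in A^T *m E]ET -trmx_mul -lE subrr.
rewrite dotpE big1// => j _; rewrite Ediag /act.
by case: eqP => [->|_]; rewrite ?mulr0// !mul0r.
Qed.

End Fixed.

(* The hypothesis says that [(nu, 0)] minimizes [qobj nu' - v t] jointly in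
   [(nu', t)]; stationarity in [t] then forces [mu i 0 = v]. *)
Lemma qmin_kkt_partial n p (M : 'M[R]_n) c (A : 'M[R]_(p, n)) b nu i (v : R) :
  M^T = M -> qfeasible A b nu ->
  (forall t nu', qfeasible A (b + t *: delta_mx i 0) nu' ->
     qobj M c nu + v * t <= qobj M c nu') ->
  exists2 mu, nonneg mu & [/\ 2 *: (M *m nu) + c + A^T *m mu = 0,
    dotp mu (A *m nu + b) = 0 & mu i 0 = v].
Proof.
move=> Msym fnu mnu.
pose M' : 'M[R]_(n + 1) := block_mx M 0 0 0.
pose c' : 'cV[R]_(n + 1) := col_mx c (- v%:M).
pose A' : 'M[R]_(p, n + 1) := row_mx A (delta_mx i 0).
have AE x (t : R) : A' *m col_mx x t%:M = A *m x + t *: delta_mx i 0.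
  by rewrite mul_row_col mul_mx_scalar.
have M'E x (t : R) : M' *m col_mx x t%:M = col_mx (M *m x) 0.
  by rewrite mul_block_col !mul0mx !addr0.
have qE x (t : R) : qobj M' c' (col_mx x t%:M) = qobj M c x - v * t.
  rewrite /qobj M'E !dotp_col_mx dotp0r addr0 -addrA; congr (_ + (_ + _)).
  by rewrite dotpNl dotpE big_ord1 !mxE eqxx !mulr1n.
have M'sym : M'^T = M' by rewrite tr_block_mx Msym !trmx0.
have [|mu mu0 [muE muc]] := @qmin_kkt _ _ M' c' A' M'sym b (col_mx nu 0%:M).
  split=> [j|x' fx']; first by rewrite AE scale0r addr0.
  have x'E : x' = col_mx (usubmx x') (dsubmx x' 0 0)%:M.
    by rewrite -[LHS]vsubmxK; congr col_mx; exact: mx11_scalar.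
  rewrite x'E !qE mulr0 subr0 lerBrDr; apply: mnu => j.
  by have := fx' j; rewrite {1}x'E AE -addrA (addrC _ b).
move: muE; rewrite M'E /c' /A' scale_col_mx add_col_mx tr_row_mx mul_col_mx.
rewrite add_col_mx -col_mx0 => /eq_col_mx[e1 e2].
exists mu => //; split=> //; first by move: muc; rewrite AE scale0r addr0.
move: e2 => /matrixP /(_ 0 0); rewrite scaler0 add0r trmx_delta.
rewrite -rowE !mxE eqxx mulr1n => /eqP.
by rewrite addrC subr_eq0 => /eqP.
Qed.

End QP.

(** * Positive definite programs: existence, uniqueness and duality *)

Section PositiveDefinite.
Variables (R : realType) (n p : nat) (eps : R).
Variables (M : 'M[R]_n) (c : 'cV[R]_n) (A : 'M[R]_(p, n)).
Hypotheses (Msym : M^T = M) (eps0 : 0 < eps).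
Hypothesis Mpos : forall d, eps * dotp d d <= dotp d (M *m d).
Implicit Types (b mu : 'cV[R]_p) (nu d : 'cV[R]_n).

Lemma cvg_fsum (T I : Type) (F : set_system T) {FF : Filter F} (r : seq I)
    (f : I -> T -> R) (l : I -> R) :
  (forall i, f i x @[x --> F] --> l i) ->
  (\sum_(i <- r) f i x) @[x --> F] --> \sum_(i <- r) l i.
Proof.
move=> fl; elim: r => [|i r IHr].
  by under eq_fun do rewrite big_nil; rewrite big_nil; exact: cvg_cst.
by under eq_fun do rewrite big_cons; rewrite big_cons; exact: cvgD.
Qed.

(** The objective is coercive, so its sublevel set at a feasible point is compact, and the extreme
    value theorem applies there. *)
Lemma qmin_exists b : qfeasible A b !=set0 -> qmin M c A b !=set0.
Proof.
move=> [nu0 fnu0].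
(* Beyond norm [B] the quadratic term, at least [eps * B] times the norm, outweighs the linear term
   and the value at [nu0]; the summand [1] makes this strict and the norm at least [1]. *)
pose B := (n%:R * `|c| + `|qobj M c nu0|) / eps + 1.
have bounded nu : qobj M c nu <= qobj M c nu0 -> `|nu| <= B.
  move=> h; rewrite leNgt; apply/negP => Bnu.
  have := norm_dotp_le c nu; rewrite ler_norml => /andP[ca _].
  have := Mpos nu; have := sqr_norm_le_dotp nu.
  rewrite -(ler_pM2l eps0) => h1 h2.
  have Beps : eps * B = n%:R * `|c| + `|qobj M c nu0| + eps.
    by rewrite /B mulrDr mulr1 mulrCA divff ?mulr1// gt_eqF.
  have B1 : 1 <= B by rewrite /B lerDr divr_ge0// ?addr_ge0 ?mulr_ge0// ltW.
  have : `|nu| * (eps * B) <= `|nu| * (eps * `|nu|).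
    by rewrite ler_wpM2l// ler_pM2l// ltW.
  have : `|qobj M c nu0| <= `|nu| * `|qobj M c nu0|.
    by rewrite ler_peMl// (le_trans B1)// ltW.
  have : 0 < `|nu| * eps by rewrite mulr_gt0// (lt_le_trans ltr01)// (le_trans B1)// ltW.
  have := ler_norm (qobj M c nu0).
  rewrite Beps; move: h; rewrite {1}/qobj; rewrite expr2 in h1; nra.
(* The extreme value theorem is applied to row vectors, hence the transposes from here on. *)
have lin_cont q (L : 'M[R]_(q, n)) j :
    continuous (fun v : 'rV[R]_n => (L *m v^T) j 0).
  move=> v; rewrite /continuous_at mxE.
  under eq_fun do rewrite mxE; apply: (@cvg_fsum 'rV[R]_n _ (nbhs v)) => i.
  apply: cvgM; first exact: cvg_cst.
  by rewrite mxE; under eq_fun do rewrite mxE; exact: coord_continuous.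
have obj_cont : continuous (fun v : 'rV[R]_n => qobj M c v^T).
  move=> v; rewrite /continuous_at /qobj; apply: (@cvgD _ _ _ (nbhs v)); last exact: lin_cont.
  rewrite dotpE; under eq_fun do rewrite dotpE; apply: (@cvg_fsum 'rV[R]_n _ (nbhs v)) => i.
  apply: cvgM; last exact: lin_cont.
  by rewrite mxE; under eq_fun do rewrite mxE; exact: coord_continuous.
pose S := [set v : 'rV[R]_n | qfeasible A b v^T /\ qobj M c v^T <= qobj M c nu0].
have Sc : compact S.
  apply: bounded_closed_compact.
    exists B; split; first exact: num_real.
    move=> x Bx v [_ /bounded vB]; apply: le_trans (ltW Bx); apply: le_trans vB.
    apply: mx_norm_le => // i j.
    by rewrite ord1 (le_trans _ (coord_le_norm _ j 0))// mxE.
  have -> : S = \bigcap_(j in [set: 'I_p])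
        ((fun v => (A *m v^T) j 0) @^-1` [set x | x <= - b j 0])
      `&` (fun v => qobj M c v^T) @^-1` [set x | x <= qobj M c nu0].
    apply/seteqP; split=> v /= [fv vle]; split=> // j.
      by move=> _ /=; have := fv j; rewrite mxE -lerBrDr sub0r.
    by rewrite mxE -lerBrDr sub0r; exact: fv.
  apply: closedI; last by apply: preimage_closed; [move=> ? _ | exact: closed_le].
  apply: closed_bigI => j _.
  by apply: preimage_closed; [move=> ? _; exact: lin_cont | exact: closed_le].
have [|v vS vmin] := @EVT_min_rV R n (fun v => qobj M c v^T) S _ Sc
    (continuous_subspaceT obj_cont).
  by exists nu0^T; rewrite /S /= trmxK.
move: vS; rewrite inE => -[fv vle].
exists v^T; split=> // nu' fnu'.
have [le0|lt0] := leP (qobj M c nu') (qobj M c nu0).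
  by have := vmin nu'^T; rewrite inE /S/= trmxK; apply.
exact: le_trans (ltW lt0).
Qed.

Lemma qmin_unique b nu nu' : qmin M c A b nu -> qfeasible A b nu' ->
  qobj M c nu' <= qobj M c nu -> nu' = nu.
Proof.
move=> mnu fnu' le_nu'; apply/eqP; rewrite -subr_eq0; apply/eqP/dotp_eq0.
apply/eqP; rewrite eq_le dotp_ge0 andbT -(ler_pM2l eps0) mulr0.
rewrite (le_trans (Mpos _))// -(lerD2l (qobj M c nu)) addr0.
by rewrite (le_trans (qmin_strong Msym mnu fnu')).
Qed.

Lemma posdef_unitmx : M \in unitmx.
Proof.
rewrite -row_free_unit -kermx_eq0; apply/eqP/row_matrixP => i; rewrite row0.
have kerM : row i (kermx M) *m M = 0 by apply/sub_kermxP; exact: row_sub.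
rewrite -[LHS]trmxK; apply/eqP; rewrite trmx_eq0; apply/eqP/dotp_eq0/eqP.
rewrite eq_le dotp_ge0 andbT -(ler_pM2l eps0) mulr0 (le_trans (Mpos _))//.
by rewrite /dotp trmxK mulmxA kerM mul0mx mxE.
Qed.

(* Completing the square in [nu]. *)
Lemma lagrangian b nu mu : let e := nu + 2^-1 *: (invmx M *m (c + A^T *m mu)) in
  qobj M c nu + dotp mu (A *m nu + b) =
  dotp e (M *m e) - qdual M c A b mu - 4^-1 * dotp c (invmx M *m c).
Proof.
move=> e; have Mi : (invmx M)^T = invmx M by rewrite trmx_inv Msym.
have eE : dotp e (M *m e) = dotp nu (M *m nu) + dotp nu (c + A^T *m mu) +
    4^-1 * dotp (invmx M *m (c + A^T *m mu)) (c + A^T *m mu).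
  rewrite /e; move: (c + _) => z; have : M *m (invmx M *m z) = z.
    by rewrite mulKVmx// posdef_unitmx.
  move: (invmx M *m z) => y My.
  rewrite mulmxDr -scalemxAr My !(dotpDl, dotpDr, dotpZl, dotpZr).
  by rewrite (dotp_symC Msym nu y) My; field.
have yzE : dotp (invmx M *m (c + A^T *m mu)) (c + A^T *m mu) =
    dotp c (invmx M *m c) + 2 * dotp mu (A *m invmx M *m c)
    + dotp mu (A *m invmx M *m A^T *m mu).
  rewrite -!mulmxA !(dotp_mulmx A); move: (A^T *m mu) => z.
  rewrite mulmxDr !(dotpDl, dotpDr) !(dotpC (invmx M *m _)).
  by rewrite (dotp_symC Mi z c); ring.
rewrite eE yzE /qobj /qdual !(dotpDl, dotpDr, dotpNl, dotpNr, dotpZl, dotpZr).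
rewrite (dotp_mulmx A mu nu) (dotpC _ mu) (dotpC _ mu) (dotpC nu c).
by rewrite (dotpC nu (A^T *m mu)); field.
Qed.

(** In [lagrangian] the completed square is nonnegative and the multiplier term nonpositive. *)
Lemma weak_duality b nu mu : qfeasible A b nu -> nonneg mu ->
  - qdual M c A b mu - 4^-1 * dotp c (invmx M *m c) <= qobj M c nu.
Proof.
move=> fnu mu0; have := lagrangian b nu mu => /=; set e := nu + _ => lag.
have : 0 <= dotp e (M *m e).
  by rewrite (le_trans _ (Mpos _))// mulr_ge0 ?dotp_ge0// ltW.
have : dotp mu (A *m nu + b) <= 0.
  by rewrite dotpE; apply: sumr_le0 => i _; apply: mulr_ge0_le0.
by move: lag; lra.
Qed.

(** Stationarity says exactly that the completed square of [lagrangian] vanishes. *)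
Lemma strong_duality b nu mu : 2 *: (M *m nu) + c + A^T *m mu = 0 ->
  dotp mu (A *m nu + b) = 0 ->
  qobj M c nu = - qdual M c A b mu - 4^-1 * dotp c (invmx M *m c).
Proof.
move=> kkt cs; have := lagrangian b nu mu; rewrite cs addr0 => /= ->.
have -> : nu + 2^-1 *: (invmx M *m (c + A^T *m mu)) = 0.
  have -> : c + A^T *m mu = - (2 *: (M *m nu)).
    by apply/eqP; rewrite -addr_eq0 addrC addrA kkt.
  rewrite mulmxN -scalemxAr mulKmx ?posdef_unitmx// scalerN scalerA.
  by rewrite mulVf ?pnatr_eq0// scale1r subrr.
by rewrite dotp0l add0r.
Qed.

(** The dual function is affine in [b]; this is what turns dual minimizers into subgradients. *)
Lemma qdual_shift b b' mu : qdual M c A b' mu = qdual M c A b mu - dotp mu (b' - b).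
Proof.
rewrite /qdual !dotpBl dotpBr !dotpZl (dotpC mu b) (dotpC mu b'); by field.
Qed.

End PositiveDefinite.

(** * Minimizers of the regularized inference program *)

Section Program.
Variables (R : realType) (ny nx ng m q r : nat) (P : hlmrf R ny nx ng m q r).
Implicit Types (w : 'cV[R]_r) (nu : 'cV[R]_(m + ny)) (y : 'cV[R]_ny).
Implicit Types (x : 'cV[R]_nx) (g : 'cV[R]_ng) (b mu : 'cV[R]_(num_ineq ny m q)).

(** The vector [Phi] with the slacks in place of the hinge values; it is the gradient of the
    objective in the weights. *)
Definition potential_sums nu : 'cV[R]_r :=
  \col_i \sum_(k in tau P i) (usubmx nu k 0) ^+ pexp P k.

Lemma qmx_sym eps w : (Dmx P w + eps%:M)^T = Dmx P w + eps%:M.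
Proof. by rewrite linearD /= tr_diag_mx tr_scalar_mx. Qed.

(** The exponent decides whether the weight of a slack sits in [Dmx] or in [cvec], so both merge
    into one sum over the slacks, which is then regrouped by parts. No sign of [w] enters, so this
    also serves weights near the boundary of the orthant. *)
Lemma objectiveE eps w nu :
  objective P eps w nu = dotp w (potential_sums nu) + eps * dotp nu nu.
Proof.
rewrite /objective mulmxDl mul_scalar_mx dotpDr dotpZr addrAC; congr (_ + _).
rewrite -{1 2 3}[nu]vsubmxK /cvec dotp_col_mx dotp0l addr0.
transitivity (\sum_k part_weight P w k * usubmx nu k 0 ^+ pexp P k).
  rewrite !dotpE big_split_ord /= [X in _ + X + _]big1 ?addr0 => [|i _]; last first.
    by rewrite mul_diag_mx !mxE !(unsplitK (inr _)) !mxE mul0r mulr0.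
  rewrite -big_split/=; apply: eq_bigr => k _.
  rewrite mul_diag_mx !mxE !(unsplitK (inl _)) !mxE.
  by case: (pexp12 P k) => -> /=; ring.
rewrite dotpE /part_weight; under eq_bigr do rewrite mulr_suml big_mkcond.
rewrite exchange_big; apply: eq_bigr => i _.
by rewrite mxE mulr_sumr [RHS]big_mkcond.
Qed.

Lemma qmx_pos eps w : nonneg w -> forall d,
  eps * dotp d d <= dotp d ((Dmx P w + eps%:M) *m d).
Proof.
move=> w0 d; rewrite mulmxDl mul_scalar_mx dotpDr dotpZr lerDr dotpE.
apply: sumr_ge0 => i _; rewrite mul_diag_mx !mxE mulrCA.
rewrite mulr_ge0 -?expr2 ?sqr_ge0//; case: splitP => j _; rewrite !mxE//.
by case: ifP => // _; apply: sumr_ge0 => k _; exact: w0.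
Qed.

Lemma minimizer_ex eps w b : 0 < eps -> nonneg w -> feasible P b !=set0 ->
  minimizer P eps w b !=set0.
Proof.
by move=> eps0 w0; apply: (qmin_exists (eps := eps)) => //; exact: qmx_pos.
Qed.

Lemma minimizer_strong eps w b nu nu' : nonneg w -> minimizer P eps w b nu ->
  feasible P b nu' ->
  objective P eps w nu + eps * dotp (nu' - nu) (nu' - nu) <= objective P eps w nu'.
Proof.
move=> w0 mnu fnu'; apply: le_trans (qmin_strong (qmx_sym eps w) mnu fnu').
by rewrite lerD2l; exact: qmx_pos.
Qed.

(** Phrased for a feasible point that does at least as well, so that it applies to competitors not
    yet known to be minimizers. *)
Lemma minimizer_unique eps w b nu nu' : 0 < eps -> nonneg w ->
  minimizer P eps w b nu -> feasible P b nu' ->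
  objective P eps w nu' <= objective P eps w nu -> nu' = nu.
Proof.
move=> eps0 w0; apply: (qmin_unique (qmx_sym eps w) eps0); exact: qmx_pos.
Qed.

Lemma minimizer_ystar eps w b nu : 0 < eps -> nonneg w ->
  minimizer P eps w b nu -> ystar P eps w b = dsubmx nu.
Proof.
move=> eps0 w0 mnu; rewrite /ystar; congr (dsubmx _).
have mx : minimizer P eps w b (xget 0 (minimizer P eps w b)) by exact: xgetI mnu.
by apply: (minimizer_unique _ _ mnu mx.1) => //; exact: mx.2 mnu.1.
Qed.

Lemma col_mx_le0 n1 n2 (u : 'cV[R]_n1) (v : 'cV[R]_n2) :
  (forall i, (col_mx u v) i 0 <= 0) <->
  (forall i, u i 0 <= 0) /\ (forall i, v i 0 <= 0).
Proof.
split=> [uv|[u0 v0] i]; last by rewrite mxE; case: splitP.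
by split=> i; [have := uv (lshift _ i) | have := uv (rshift _ i)];
  rewrite ?col_mxEu ?col_mxEd.
Qed.

Lemma feasible_bvecP x g s y : feasible P (bvec P x g) (col_mx s y) <->
  [/\ forall k, (ac_y P *m y + (ac_x P *m x + ac_g P *m g + bc P)) k 0 <= 0,
      forall k, ell P x g y k 0 <= s k 0, forall k, 0 <= s k 0 & unit_box y].
Proof.
rewrite /feasible /= /Amx /bvec !mul_col_mx !mul_row_col !add_col_mx.
rewrite !mul0mx !mulNmx !mul1mx !add0r !addr0.
rewrite !col_mx_le0; split.
  move=> [h [[e s0] [y0 y1]]]; split=> // k.
  - by have := e k; rewrite /ell !mxE; lra.
  - by have := s0 k; rewrite !mxE oppr_le0.
  - by have := y0 k; have := y1 k; rewrite !mxE oppr_le0 subr_le0 => -> ->.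
move=> [h e s0 y01]; split=> //; split; split=> k.
- by have := e k; rewrite /ell !mxE; lra.
- by rewrite !mxE oppr_le0.
- by have /andP[] := y01 k; rewrite !mxE oppr_le0.
- by have /andP[] := y01 k; rewrite !mxE subr_le0.
Qed.

(** Lowering the slacks to the hinge values keeps feasibility and does not raise the objective;
    uniqueness then forces equality, even for slacks of weight zero. *)
Lemma minimizer_slack eps w x g nu : 0 < eps -> nonneg w ->
  minimizer P eps w (bvec P x g) nu ->
  forall k, usubmx nu k 0 = Num.max (ell P x g (dsubmx nu) k 0) 0.
Proof.
move=> eps0 w0 mnu k; have [fnu _] := mnu.
pose s : 'cV[R]_m := \col_k Num.max (ell P x g (dsubmx nu) k 0) 0.
move: fnu; rewrite -{1}[nu]vsubmxK => /feasible_bvecP[h e s0 y01].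
have s_le j : 0 <= s j 0 <= usubmx nu j 0.
  by rewrite mxE le_max lexx orbT/= ge_max e s0.
suff <- : col_mx s (dsubmx nu) = nu by rewrite col_mxKu mxE col_mxKd.
apply: (minimizer_unique _ _ mnu) => //.
  apply/feasible_bvecP; split=> // j; last by have /andP[] := s_le j.
  by rewrite [s _ _]mxE le_max lexx.
rewrite !objectiveE lerD//.
  rewrite !dotpE; apply: ler_sum => i _; rewrite ler_wpM2l// !mxE.
  apply: ler_sum => j _; rewrite col_mxKu lerXn2r ?nnegrE//.
  by have /andP[] := s_le j.
  by have /andP[] := s_le j.
rewrite ler_pM2l// -{3 4}[nu]vsubmxK !dotp_col_mx lerD2r !dotpE.
by apply: ler_sum => j _; have /andP[? ?] := s_le j; rewrite ler_pM.
Qed.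

Lemma minimizer_Phi eps w x g nu : 0 < eps -> nonneg w ->
  minimizer P eps w (bvec P x g) nu ->
  Phi P (dsubmx nu) x g = potential_sums nu.
Proof.
move=> eps0 w0 mnu; apply/matrixP => i j; rewrite !mxE; apply: eq_bigr => k _.
by rewrite (minimizer_slack eps0 w0 mnu).
Qed.

(** The targets lie in the unit box and the slacks are hinge values over that box, so neither [eps]
    nor [w] enters the bound. *)
Lemma minimizer_bound x g : exists2 T : R, 1 <= T &
  forall eps w nu, 0 < eps -> nonneg w -> minimizer P eps w (bvec P x g) nu ->
    `|nu| <= T.
Proof.
pose rest := aphi_x P *m x + aphi_g P *m g + bphi P.
(* [T k] bounds the affine form of potential [k] on the unit box. *)
pose T k := \sum_j `|aphi_y P k j| + `|rest k 0|.
have T0 k : 0 <= T k by rewrite addr_ge0// sumr_ge0.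
have sumT0 : 0 <= \sum_k T k by rewrite sumr_ge0.
exists (1 + \sum_k T k) => [|eps w nu eps0 w0 mnu]; first by rewrite lerDl.
have [fnu _] := mnu.
move: fnu; rewrite -{1}[nu]vsubmxK => /feasible_bvecP[h e s0 y01].
apply: norm_le_coord => [|i]; first by rewrite addr_ge0.
rewrite -{1}[nu]vsubmxK mxE; case: splitP => j _; last first.
  by have /andP[y0 y1] := y01 j; rewrite ger0_norm// (le_trans y1)// lerDl.
rewrite (minimizer_slack eps0 w0 mnu) ger0_norm ?le_max ?lexx ?orbT//.
rewrite ge_max addr_ge0// andbT (@le_trans _ _ (T j))//; last first.
  by rewrite (bigD1 j)//= addrCA lerDl addr_ge0// sumr_ge0.
have -> : ell P x g (dsubmx nu) j 0 = (aphi_y P *m dsubmx nu) j 0 + rest j 0.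
  by rewrite /ell /rest -!addrA mxE.
rewrite (le_trans (ler_norm _))// (le_trans (ler_normD _ _))// /T lerD2r mxE.
rewrite (le_trans (ler_norm_sum _ _ _))//.
apply: ler_sum => l _; rewrite normrM ler_piMr//.
by have /andP[y0 y1] := y01 l; rewrite ger0_norm.
Qed.

(** Only [nu] is bounded, because [nu'] will be an arbitrary feasible point in [V_quadratic_approx];
    the price is the squared term. *)
Lemma potential_sums_diff nu nu' (T : R) : 0 <= T -> `|nu| <= T ->
  `|potential_sums nu' - potential_sums nu|
    <= m%:R * (`|nu' - nu| ^+ 2 + (2 * T + 1) * `|nu' - nu|).
Proof.
move=> T0 nuT; set D := `|nu' - nu|.
have D0 : 0 <= D by exact: normr_ge0.
have D1 : 0 <= D ^+ 2 + (2 * T + 1) * D.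
  by rewrite addr_ge0 ?sqr_ge0// mulr_ge0// addr_ge0// mulr_ge0.
apply: norm_le_coord => [|i]; first by rewrite mulr_ge0.
rewrite !mxE -sumrB (le_trans (ler_norm_sum _ _ _))//.
rewrite (@le_trans _ _ (\sum_(k in tau P i) (D ^+ 2 + (2 * T + 1) * D)))//; last first.
  rewrite sumr_const -[leLHS]mulr_natl ler_wpM2r// ler_nat.
  by rewrite -[leqRHS]card_ord max_card.
apply: ler_sum => k _; set s' := usubmx nu' k 0; set s := usubmx nu k 0.
have sT : `|s| <= T by rewrite (le_trans _ nuT)// /s mxE coord_le_norm.
have sD : `|s' - s| <= D.
  by rewrite (le_trans _ (coord_le_norm _ (lshift _ k) 0))// /s' /s !mxE.
have /orP[/eqP->|/eqP->] : (pexp P k == 1%N) || (pexp P k == 2%N).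
    by case: (pexp12 P k) => ->.
  by rewrite !expr1 (le_trans sD)//; nra.
rewrite subr_sqr normrM (@le_trans _ _ (D * (D + 2 * T)))//; last by nra.
rewrite ler_pM//; have -> : s' + s = (s' - s) + 2 * s by ring.
by rewrite (le_trans (ler_normD _ _))// lerD// normrM ger0_norm// ler_wpM2l.
Qed.

(* Adding the two strong minimality inequalities leaves
   [2 eps |d|^2 <= <w - w', Phi(nu') - Phi(nu)>]. *)
Lemma minimizer_lipschitz x g : exists2 C : R, 0 <= C &
  forall eps w w' nu nu', 0 < eps -> nonneg w -> nonneg w' ->
    minimizer P eps w (bvec P x g) nu -> minimizer P eps w' (bvec P x g) nu' ->
    `|nu - nu'| <= C / eps * `|w - w'| /\
    `|potential_sums nu - potential_sums nu'| <= C / eps * `|w - w'|.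
Proof.
have [T T1 nuT] := minimizer_bound x g.
have T0 : 0 <= T by rewrite (le_trans ler01).
(* Both minimizers have norm at most [T], hence distance at most [2 * T], and [G] is a Lipschitz
   constant of [potential_sums] between them. *)
pose G := m%:R * (4 * T + 1).
have G0 : 0 <= G by rewrite mulr_ge0// addr_ge0// mulr_ge0.
have C0 : 0 <= r%:R * G by rewrite mulr_ge0.
(* [r%:R * G] serves for the minimizers and a further factor [G] for their potential sums; the sum
   of the two dominates both. *)
exists (r%:R * G * (1 + G)).
  by rewrite mulr_ge0// addr_ge0.
move=> eps w w' nu nu' eps0 w0 w'0 mnu mnu'.
have bnu := nuT _ _ _ eps0 w0 mnu; have bnu' := nuT _ _ _ eps0 w'0 mnu'.
have GL : `|potential_sums nu - potential_sums nu'| <= G * `|nu - nu'|.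
  rewrite (le_trans (potential_sums_diff nu T0 bnu'))// /G -mulrA ler_wpM2l//.
  have : `|nu - nu'| <= 2 * T.
    by rewrite (le_trans (ler_normB _ _))// mulr_natl mulr2n lerD.
  have := normr_ge0 (nu - nu').
  by nra.
have Ce0 : 0 <= r%:R * G / eps by rewrite divr_ge0// ltW.
have nuL : `|nu - nu'| <= r%:R * G / eps * `|w - w'|.
  have := minimizer_strong w0 mnu mnu'.1.
  have := minimizer_strong w'0 mnu' mnu.1.
  have -> : dotp (nu' - nu) (nu' - nu) = dotp (nu - nu') (nu - nu').
    by rewrite -(opprB nu nu') dotpNl dotpNr opprK.
  rewrite !objectiveE => h1 h2.
  have := norm_dotp_le (w - w') (potential_sums nu - potential_sums nu').
  rewrite ler_norml => /andP[+ _]; rewrite dotpBr !dotpBl => h3.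
  have := sqr_norm_le_dotp (nu - nu'); rewrite -(ler_pM2l eps0) => h4.
  have h5 : r%:R * `|w - w'| * `|potential_sums nu - potential_sums nu'|
      <= r%:R * `|w - w'| * (G * `|nu - nu'|).
    by rewrite ler_wpM2l// mulr_ge0.
  (* One factor of the distance is cancelled below, so distance zero is set apart. *)
  have [->|d0] := eqVneq `|nu - nu'| 0.
    by rewrite mulr_ge0.
  have d1 : 0 < `|nu - nu'| by rewrite lt_neqAle eq_sym d0 /=.
  rewrite mulrAC ler_pdivlMr// -(ler_pM2l d1).
  rewrite expr2 in h4.
  have : 0 <= eps * (`|nu - nu'| * `|nu - nu'|) by rewrite !mulr_ge0// ltW.
  by lra.
have K0 : 0 <= r%:R * G / eps * `|w - w'|.
  by rewrite mulr_ge0.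
have -> : r%:R * G * (1 + G) / eps * `|w - w'| =
  r%:R * G / eps * `|w - w'| + G * (r%:R * G / eps * `|w - w'|) by ring.
split; first by rewrite (le_trans nuL)// lerDl mulr_ge0.
by rewrite (le_trans GL)// (le_trans (ler_wpM2l G0 nuL))// lerDr.
Qed.

End Program.

(** * The value function: convexity, expansion in the weights, subgradients in the constants *)

Section ValueFunction.
Variables (R : realType) (ny nx ng m q r : nat) (P : hlmrf R ny nx ng m q r).
Implicit Types (w : 'cV[R]_r) (nu : 'cV[R]_(m + ny)) (y : 'cV[R]_ny).
Implicit Types (x : 'cV[R]_nx) (g : 'cV[R]_ng) (b mu : 'cV[R]_(num_ineq ny m q)).

Lemma V_le eps w b nu : feasible P b nu ->
  (V P eps w b <= (objective P eps w nu)%:E)%E.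
Proof. by move=> fnu; apply: ereal_inf_lbound; exists nu. Qed.

Lemma V_ge eps w b a :
  (forall nu, feasible P b nu -> (a <= (objective P eps w nu)%:E)%E) ->
  (a <= V P eps w b)%E.
Proof. by move=> h; apply: le_ereal_inf_tmp => _ [nu fnu <-]; exact: h. Qed.

Lemma V_minimizer eps w b nu : minimizer P eps w b nu ->
  V P eps w b = (objective P eps w nu)%:E.
Proof.
move=> [fnu mnu]; apply/le_anti; rewrite V_le//=.
by apply: V_ge => nu' fnu'; rewrite lee_fin mnu.
Qed.

Lemma V_infeasible eps w b : ~ (feasible P b !=set0) -> V P eps w b = +oo%E.
Proof.
move=> nf; apply/eqP; rewrite -leye_eq; apply: V_ge => nu fnu.
by exfalso; apply: nf; exists nu.
Qed.

Lemma V_gtNy eps w b : 0 < eps -> nonneg w -> (-oo < V P eps w b)%E.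
Proof.
move=> eps0 w0; have [f|nf] := pselect (feasible P b !=set0).
  by have [nu /V_minimizer ->] := minimizer_ex eps0 w0 f; rewrite ltNyr.
by rewrite V_infeasible.
Qed.

(** An infimum of functions affine in [w], over a feasible set that does not depend on [w]. *)
Lemma V_concave eps b : econcave_on nonneg (fun w => V P eps w b).
Proof.
move=> w w' w0 w'0 t /andP[t0 t1]; apply: V_ge => nu fnu.
have -> : objective P eps (t *: w + (1 - t) *: w') nu =
    t * objective P eps w nu + (1 - t) * objective P eps w' nu.
  by rewrite !objectiveE dotpDl !dotpZl; ring.
rewrite [leRHS]EFinD !EFinM; apply: leeD; apply: lee_wpmul2l; rewrite ?lee_fin ?subr_ge0//;
  exact: V_le.
Qed.

(** The combination of two minimizers is feasible for the combined constants, and the objective is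
    convex in [nu]. *)
Lemma V_convex eps w : 0 < eps -> nonneg w ->
  econvex_on setT (fun b => V P eps w b).
Proof.
move=> eps0 w0 b b' _ _ t /andP[t0 t1].
(* Since [0 * +oo = 0], the endpoints are separated from the case where infeasible constants make
   the right-hand side [+oo]. *)
have [->|tn0] := eqVneq t 0.
  by rewrite scale0r subr0 scale1r add0r mul0e mul1e add0e.
have [->|tn1] := eqVneq t 1.
  by rewrite subrr scale0r scale1r addr0 mul0e mul1e adde0.
have tp : 0 < t by rewrite lt_neqAle eq_sym tn0.
have t'p : 0 < 1 - t by rewrite subr_gt0 lt_neqAle tn1.
have VNy b0 (s : R) : 0 < s -> (s%:E * V P eps w b0 != -oo)%E.
  move=> s0; move: (V_gtNy b0 eps0 w0); case: (V P eps w b0) => [v _|_|].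
  - by rewrite -EFinM.
  - by rewrite gt0_muley ?lte_fin.
  - by rewrite ltxx.
have [f|nf] := pselect (feasible P b !=set0); last first.
  by rewrite (V_infeasible _ _ nf) gt0_muley ?lte_fin// addye ?VNy// leey.
have [f'|nf] := pselect (feasible P b' !=set0); last first.
  by rewrite (V_infeasible _ _ nf) gt0_muley ?lte_fin// addey ?VNy// leey.
have [nu mnu] := minimizer_ex eps0 w0 f.
have [nu' mnu'] := minimizer_ex eps0 w0 f'.
rewrite (V_minimizer mnu) (V_minimizer mnu') -!EFinM -EFinD.
have fc : feasible P (t *: b + (1 - t) *: b') (t *: nu + (1 - t) *: nu').
  by apply: qfeasible_convex; [rewrite t0 | exact: mnu.1 | exact: mnu'.1].
apply: le_trans (V_le _ _ fc) _; rewrite lee_fin.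
have Msym := qmx_sym P eps w; have Mpos := qmx_pos P eps w0.
have oE s := qobj_line (cvec P w) Msym nu' (nu - nu') s.
change (objective P eps w) with (qobj (Dmx P w + eps%:M) (cvec P w)).
have -> : t *: nu + (1 - t) *: nu' = nu' + t *: (nu - nu').
  by rewrite scalerBr scalerBl scale1r addrCA.
rewrite oE; have := oE 1; rewrite scale1r subrKC => ->.
have : 0 <= dotp (nu - nu') ((Dmx P w + eps%:M) *m (nu - nu')).
  by rewrite (le_trans _ (Mpos _))// mulr_ge0 ?dotp_ge0// ltW.
move: (dotp (nu - nu') _) (dotp (2 *: _ + _) _) (qobj _ _ _) => A B C A0.
rewrite -subr_ge0; have -> : t * (C + (1 * B + 1 ^+ 2 * A)) + (1 - t) * C
    - (C + (t * B + t ^+ 2 * A)) = t * (1 - t) * A by ring.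
by rewrite !mulr_ge0// ltW.
Qed.

(* The upper bound tests [V] at the minimizer for [w]; in the lower bound the
   quadratic growth of the objective around it absorbs the variation of the
   potentials, so that no minimizer is needed for the perturbed [w']. *)
Lemma V_quadratic_approx eps w b nu : 0 < eps -> nonneg w ->
  minimizer P eps w b nu -> exists d C : R, [/\ 0 < d, 0 <= C & forall w',
    `|w' - w| < d -> V P eps w' b \is a fin_num /\
    `|fine (V P eps w' b) - fine (V P eps w b)
      - dotp (potential_sums P nu) (w' - w)| <= C * `|w' - w| ^+ 2].
Proof.
move=> eps0 w0 mnu.
pose T := `|nu|; pose L := r%:R * m%:R : R.
have T0 : 0 <= T by exact: normr_ge0.
have L0 : 0 <= L by rewrite mulr_ge0.
have L1 : 0 < 2 * (L + 1) by rewrite mulr_gt0// ltr_wpDl.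
pose K := L * (2 * T + 1).
(* Within this radius the quadratic part of the variation of the potentials uses at most half of the
   growth [eps * e ^+ 2]; the other half absorbs the linear part [K * dw * e] by Young's inequality,
   which leaves the stated constant. *)
exists (eps / (2 * (L + 1))), (K ^+ 2 / (2 * eps)); split.
- by rewrite divr_gt0.
- by rewrite divr_ge0 ?sqr_ge0// mulr_ge0// ltW.
move=> w' w'w; set dw := `|w' - w|; set p := dotp (potential_sums P nu) (w' - w).
have dw0 : 0 <= dw by exact: normr_ge0.
have dwL : dw * L <= eps / 2.
  move: w'w; rewrite -/dw ltr_pdivlMr// => h.
  by rewrite ler_pdivlMr//; nra.
have shift nu' : objective P eps w' nu' =
    objective P eps w nu' + dotp (potential_sums P nu') (w' - w).
  by rewrite !objectiveE dotpBr ![dotp (potential_sums P nu') _]dotpC; ring.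
have VE := V_minimizer mnu.
have up : (V P eps w' b <= (objective P eps w nu + p)%:E)%E.
  by rewrite -shift V_le//; exact: mnu.1.
have lo : ((objective P eps w nu + p - K ^+ 2 / (2 * eps) * dw ^+ 2)%:E
            <= V P eps w' b)%E.
  apply: V_ge => nu' fnu'; rewrite lee_fin shift.
  have := minimizer_strong w0 mnu fnu'.
  have := ler_wpM2l (ltW eps0) (sqr_norm_le_dotp (nu' - nu)).
  have := potential_sums_diff P nu' T0 (lexx T).
  have := norm_dotp_le (potential_sums P nu' - potential_sums P nu) (w' - w).
  rewrite ler_norml dotpBl -/p -/dw => /andP[+ _].
  have := normr_ge0 (nu' - nu); set e := `|nu' - nu|.
  move=> e0 h1 h2 h3 h4.
  have h5 : r%:R * `|potential_sums P nu' - potential_sums P nu| * dw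
      <= r%:R * (m%:R * (e ^+ 2 + (2 * T + 1) * e)) * dw.
    by rewrite ler_wpM2r// ler_wpM2l.
  have h6 : r%:R * (m%:R * (e ^+ 2 + (2 * T + 1) * e)) * dw =
      dw * L * e ^+ 2 + K * dw * e by rewrite /K /L; ring.
  have h7 : dw * L * e ^+ 2 <= eps / 2 * e ^+ 2 by rewrite ler_wpM2r// sqr_ge0.
  have h8 : K * dw * e <= eps / 2 * e ^+ 2 + K ^+ 2 / (2 * eps) * dw ^+ 2.
    have : 0 <= (eps * e - K * dw) ^+ 2 / (2 * eps).
      by rewrite divr_ge0 ?sqr_ge0// mulr_ge0// ltW.
    have -> : (eps * e - K * dw) ^+ 2 / (2 * eps) =
      eps / 2 * e ^+ 2 + K ^+ 2 / (2 * eps) * dw ^+ 2 - K * dw * e.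
      by field; rewrite gt_eqF.
    by rewrite subr_ge0.
  by move: h1 h2 h3 h4 h5 h7 h8; rewrite h6; lra.
have fin : V P eps w' b \is a fin_num.
  by apply/fin_numPlt/andP; split; [apply: lt_le_trans lo|apply: le_lt_trans up _];
    rewrite ?ltNyr ?ltry.
split=> //; rewrite VE /=; rewrite -[V _ _ w' _](fineK fin) lee_fin in up.
rewrite -[V _ _ w' _](fineK fin) lee_fin in lo.
have : 0 <= K ^+ 2 / (2 * eps) * dw ^+ 2.
  by rewrite mulr_ge0 ?sqr_ge0// divr_ge0 ?sqr_ge0// mulr_ge0// ltW.
by rewrite ler_norml; move: up lo; lra.
Qed.

(** A subgradient is a multiplier by [qmin_kkt_partial]. Conversely, weak duality at the shifted
    constants bounds the value from below by a function affine in the shift, with slope [mu i 0]. *)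
Lemma partial_subdiff_dual eps w b i : 0 < eps -> nonneg w ->
  feasible P b !=set0 ->
  partial_subdiff (V P eps w) i b !=set0 /\
  partial_subdiff (V P eps w) i b = [set mu i 0 | mu in dual_argmin P eps w b].
Proof.
move=> eps0 w0 f; have [nu mnu] := minimizer_ex eps0 w0 f.
have Msym := qmx_sym P eps w; have Mpos := qmx_pos P eps w0.
have VE := V_minimizer mnu.
have kkt_argmin mu : nonneg mu ->
    2 *: ((Dmx P w + eps%:M) *m nu) + cvec P w + (Amx P)^T *m mu = 0 ->
    dotp mu (Amx P *m nu + b) = 0 -> dual_argmin P eps w b mu.
  move=> mu0 kkt cs; split=> // mu' mu'0.
  have := weak_duality (cvec P w) Msym eps0 Mpos mnu.1 mu'0.
  by rewrite (strong_duality Msym eps0 Mpos kkt cs) lerD2r lerN2.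
(* By strong duality [mu0] attains the optimal dual value, with which the other dual minimizers are
   compared; it also yields a subgradient. *)
have [mu0 mu00 [kkt0 cs0]] := qmin_kkt Msym mnu.
have eq : partial_subdiff (V P eps w) i b
    = [set mu i 0 | mu in dual_argmin P eps w b].
  apply/seteqP; split=> [v [_ vP]|_ [mu [mup mumin] <-]].
    have [|mu mup [kkt cs <-]] := @qmin_kkt_partial _ _ _ (Dmx P w + eps%:M)
        (cvec P w) (Amx P) b nu i v Msym mnu.1.
      move=> t nu' fnu'; rewrite -lee_fin EFinD.
      apply: le_trans (V_le eps w fnu').
      by have := vP t; rewrite VE.
    by exists mu => //; exact: kkt_argmin.
  split=> [|t]; first by rewrite VE.
  rewrite VE -EFinD; apply: V_ge => nu' fnu'; rewrite lee_fin.
  apply: le_trans (weak_duality (cvec P w) Msym eps0 Mpos fnu' mup).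
  rewrite (qdual_shift _ _ _ b) (addrC b) addrK dotpZr dotp_delta.
  have := strong_duality Msym eps0 Mpos kkt0 cs0.
  have := mumin _ mu00; rewrite /hdual /objective -/(qdual _ _ _ _ _).
  by rewrite /qdual /qobj; lra.
by split=> //; rewrite eq; exists (mu0 i 0), mu0 => //; exact: kkt_argmin.
Qed.

End ValueFunction.

(** * Differentials from quadratic expansions, and a chain rule for regular subgradients *)

Section Differentiability.
Variable R : realType.

Lemma mulmx_continuous n p k (L : 'M[R]_(n, p)) :
  continuous (mulmx L : 'M[R]_(p, k) -> 'M[R]_(n, k)).
Proof.
have nLX (X : 'M[R]_(p, k)) : `|L *m X| <= p%:R * `|L| * `|X|.
  apply: mx_norm_le => [|i j]; first by rewrite !mulr_ge0.
  rewrite mxE (le_trans (ler_norm_sum _ _ _))//.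
  rewrite (@le_trans _ _ (\sum_(l < p) `|L| * `|X|))//.
    by apply: ler_sum => l _; rewrite normrM ler_pM ?coord_le_norm.
  by rewrite sumr_const card_ord -mulrA mulr_natl.
move=> X; apply/(@cvgrPdist_le _ _ _ (nbhs X)) => e e0; near=> Y.
rewrite -mulmxBr (le_trans (nLX _))//.
rewrite (@le_trans _ _ ((p%:R * `|L| + 1) * `|X - Y|))//.
  by rewrite ler_wpM2r// lerDl.
rewrite mulrC -ler_pdivlMr ?ltr_wpDl ?mulr_ge0//; near: Y.
apply: (@cvgr_dist_le _ _ _ (nbhs X) _ id X); first exact: cvg_id.
by rewrite divr_gt0// ltr_wpDl// mulr_ge0.
Unshelve. all: by end_near. Qed.

Lemma mulmx_differentiable n p (L : 'M[R]_(n, p)) (v : 'cV[R]_p) :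
  differentiable (mulmx L : 'cV[R]_p -> 'cV[R]_n) v.
Proof. exact/linear_differentiable/mulmx_continuous. Qed.

Lemma dotp_continuous n (g : 'cV[R]_n) : continuous (dotp g : 'cV[R]_n -> R^o).
Proof.
move=> v; apply: (@continuous_comp _ _ _ (mulmx g^T) (fun N : 'M[R]_1 => N 0 0)).
  exact: mulmx_continuous.
exact: coord_continuous.
Qed.

(** A quadratic error is little-o of the increment, so uniqueness of the differential identifies it
    with [dotp g]. *)
Lemma quadratic_approx_diff n (F : 'cV[R]_n -> R) (w g : 'cV[R]_n) (C d : R) :
  0 < d -> 0 <= C ->
  (forall w', `|w' - w| < d ->
     `|F w' - F w - dotp g (w' - w)| <= C * `|w' - w| ^+ 2) ->
  differentiable (F : 'cV[R]_n -> R^o) w /\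
  forall v, 'D_v (F : 'cV[R]_n -> R^o) w = dotp g v.
Proof.
move=> d0 C0 Fw.
have g_lin : linear (dotp g : 'cV[R]_n -> R^o).
  by move=> a u v; rewrite dotpDr dotpZr.
pose gM := GRing.isLinear.Build _ _ _ _ _ g_lin.
pose gL : {linear 'cV[R]_n -> R^o} := HB.pack (dotp g : 'cV[R]_n -> R^o) gM.
have gc : continuous gL by exact: dotp_continuous.
have Fo : (F : 'cV[R]_n -> R^o) \o shift w = cst (F w : R^o) + gL +o_ (0 : 'cV[R]_n) id.
  apply/eqaddoP => e e0; near=> h.
  have hd : `|h| < d.
    by near: h; exact: (@nbhs0_lt R 'cV[R]_n d d0).
  have hC : (C + 1) * `|h| <= e.
    rewrite mulrC -ler_pdivlMr ?ltr_wpDl//; near: h.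
    by apply: (@nbhs0_le R 'cV[R]_n); rewrite divr_gt0// ltr_wpDl.
  have := Fw (h + w); rewrite addrK => /(_ hd) => h1.
  rewrite /= opprD addrA [leLHS](_ : _ = `|F (h + w) - F w - dotp g h|)//.
  rewrite (le_trans h1)// expr2 mulrA ler_wpM2r// (le_trans _ hC)//.
  by rewrite ler_wpM2r// lerDl.
have dE := diff_unique gc Fo.
have dF : differentiable (F : 'cV[R]_n -> R^o) w.
  by apply/diff_locallyP; rewrite dE.
by split=> // v; rewrite deriveE// dE.
Unshelve. all: by end_near. Qed.

Lemma diff_jac n p (f : 'cV[R]_n -> 'cV[R]_p) x v : differentiable f x ->
  'd f x v = jac f x *m v.
Proof.
move=> df; have vE : v = \sum_j v j 0 *: delta_mx j 0.
  by rewrite [LHS]matrix_sum_delta; apply: eq_bigr => j _; rewrite big_ord1.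
rewrite {1}vE linear_sum; apply/matrixP => i k; rewrite ord1 summxE mxE.
by apply: eq_bigr => j _; rewrite linearZ /= !mxE deriveE// mulrC.
Qed.

(** The subgradient inequality is taken at [f x'], and the first-order expansion of [f] is inserted
    into its linear term. *)
Lemma reg_subdiff_comp n p (F : 'cV[R]_p -> \bar R) (f : 'cV[R]_n -> 'cV[R]_p) x v :
  differentiable f x -> subdiff F (f x) v ->
  reg_subdiff (F \o f) x ((jac f x)^T *m v).
Proof.
move=> df [Ffin vP]; split=> // e e0.
have /eqaddoP fo := diff_locally df.
(* Pairing with [v] enlarges the expansion error by at most [k], hence the tolerance [e / k] for
   [f]; the summand [1] keeps [k] positive. *)
pose k := p%:R * `|v| + 1.
have k0 : 0 < k by rewrite ltr_wpDl// mulr_ge0.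
have fnear : \forall x' \near x,
    `|f x' - f x - jac f x *m (x' - x)| <= e / k * `|x' - x|.
  rewrite (near_shift 0 x) subr0; near=> h.
  rewrite /= addrK -diff_jac// -addrA -opprD.
  by near: h; exact: fo _ (divr_gt0 e0 k0).
near=> x'.
apply: le_trans (vP (f x')); rewrite leeD2l// lee_fin.
have D1 : `|f x' - f x - jac f x *m (x' - x)| <= e / k * `|x' - x|.
  by near: x'; exact: fnear.
have := norm_dotp_le v (f x' - f x - jac f x *m (x' - x)).
rewrite ler_norml => /andP[+ _]; rewrite dotpBr dotp_mulmx => h1.
have D2 := ler_wpM2l (mulr_ge0 (ler0n R p) (normr_ge0 v)) D1.
have D3 : p%:R * `|v| * (e / k * `|x' - x|) <= e * `|x' - x|.
  rewrite mulrA ler_wpM2r// mulrCA ler_piMr ?(ltW e0)//.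
  by rewrite ler_pdivrMr// mul1r lerDl.
have D4 := ler_wpM2l (ltW e0) (norm_le_norm2 (x' - x)).
by move: h1 D2 D3 D4; lra.
Unshelve. all: by end_near. Qed.

End Differentiability.

(** * Smoothness under affine maps *)

Section Smooth.
Variable R : realType.

Lemma smooth_affine n p k (L : 'M[R]_(k, p)) (c : 'cV[R]_k) (f : 'cV[R]_n -> 'cV[R]_p) :
  smooth f -> smooth (fun x => L *m f x + c).
Proof.
move=> [df cf].
have dL y : is_diff y (mulmx L : 'cV[R]_p -> 'cV[R]_k) (mulmx L).
  apply: DiffDef; first exact: mulmx_differentiable.
  by apply: diff_lin; exact: mulmx_continuous.
have dh x := is_diffD (is_diff_comp (differentiableP (df x)) (dL (f x)))
  (is_diff_cst c x).
split=> [x|]; first by case: (dh x).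
have -> : jac (fun x => L *m f x + c) = mulmx L \o jac f.
  apply/funext => x; apply/matrixP => i j; have [dLf dLfE] := dh x.
  rewrite mxE deriveE; last exact: dLf.
  have E := congr1 (fun F : 'cV[R]_n -> 'cV[R]_k => F (delta_mx j 0) i 0) dLfE.
  transitivity ((L *m 'd f x (delta_mx j 0) + 0) i 0); first exact: E.
  rewrite addr0.
  by rewrite [LHS]mxE [RHS]mxE; apply: eq_bigr => l _; rewrite [in RHS]mxE deriveE.
by move=> x; apply: continuous_comp; [exact: cf | exact: mulmx_continuous].
Qed.

End Smooth.

Theorem theorem11 (R : realType) (ny nx ng m q r : nat)
    (ny_gt0 : (0 < ny)%N) (nx_gt0 : (0 < nx)%N) (ng_gt0 : (0 < ng)%N)
    (m_gt0 : (0 < m)%N) (r_gt0 : (0 < r)%N)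
    (P : hlmrf R ny nx ng m q r)
    (Xnn : Type) (gnn : Xnn -> 'cV[R]_ng -> 'cV[R]_ng)
    (xsy : 'cV[R]_nx) (xnn : Xnn)
    (xsy01 : unit_box xsy)
    (gnn01 : forall wnn, unit_box (gnn xnn wnn))
    (feas : forall wnn, feasible P (bvec P xsy (gnn xnn wnn)) !=set0) :
  let g wnn := gnn xnn wnn in
  let b wnn := bvec P xsy (g wnn) in
  (* the minimizer is well defined *)
  (forall (eps : R) (w : 'cV[R]_r) (wnn : 'cV[R]_ng), 0 < eps -> nonneg w ->
     exists! nu, minimizer P eps w (b wnn) nu) /\
  (* 1 *)
  (forall wnn : 'cV[R]_ng, exists K : R,
     forall eps : R, 0 < eps ->
     forall w w' : 'cV[R]_r, nonneg w -> nonneg w' ->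
       norm2 (ystar P eps w (b wnn) - ystar P eps w' (b wnn))
         <= K / eps * norm2 (w - w')) /\
  (* 2 *)
  (forall eps : R, 0 < eps ->
     (forall b0, econcave_on nonneg (fun w => V P eps w b0)) /\
     (forall w, nonneg w -> econvex_on setT (fun b0 => V P eps w b0))) /\
  (* 3 *)
  (forall (eps : R) (wnn : 'cV[R]_ng), 0 < eps ->
     (forall w, nonneg w ->
        ediff (fun w' => V P eps w' (b wnn)) w /\
        egrad (fun w' => V P eps w' (b wnn)) w
          = Phi P (ystar P eps w (b wnn)) xsy (g wnn)) /\
     (exists L : R, forall w w' : 'cV[R]_r, nonneg w -> nonneg w' ->
        norm2 (egrad (fun u => V P eps u (b wnn)) w
               - egrad (fun u => V P eps u (b wnn)) w')
          <= L * norm2 (w - w'))) /\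
  (* 4 *)
  (forall (eps : R) (w : 'cV[R]_r) (wnn : 'cV[R]_ng), 0 < eps -> nonneg w ->
     (forall i : 'I_(num_ineq ny m q),
        (exists2 nu, feasible P (b wnn) nu
                   & (row i (Amx P) *m nu) 0 0 + b wnn i 0 < 0) ->
        partial_subdiff (V P eps w) i (b wnn) !=set0 /\
        partial_subdiff (V P eps w) i (b wnn)
          = [set mu i 0 | mu in dual_argmin P eps w (b wnn)]) /\
     (smooth g ->
        smooth b /\
        [set (jac b wnn)^T *m v | v in subdiff (V P eps w) (b wnn)]
          `<=` reg_subdiff (fun wnn' => V P eps w (b wnn')) wnn)).
Proof.
move=> g b.
have minE eps w wnn : 0 < eps -> nonneg w -> minimizer P eps w (b wnn) !=set0.
  by move=> eps0 w0; apply: minimizer_ex => //; exact: feas.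
split=> [eps w wnn eps0 w0|].
  have [nu mnu] := minE eps w wnn eps0 w0; exists nu; split=> // nu' mnu'.
  by apply: (minimizer_unique eps0 w0 mnu' mnu.1); exact: mnu.2 mnu'.1.
split=> [wnn|].
  have [C C0 lip] := minimizer_lipschitz P xsy (g wnn).
  (* The factor [ny%:R] passes from the max norm to the Euclidean norm. *)
  exists (ny%:R * C) => eps eps0 w w' w0 w'0.
  have [nu mnu] := minE eps w wnn eps0 w0.
  have [nu' mnu'] := minE eps w' wnn eps0 w'0.
  rewrite (minimizer_ystar eps0 w0 mnu) (minimizer_ystar eps0 w'0 mnu').
  have [nuL _] := lip _ _ _ _ _ eps0 w0 w'0 mnu mnu'.
  rewrite (le_trans (norm2_le_norm _))// -!mulrA ler_wpM2l// mulrA.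
  rewrite (@le_trans _ _ `|nu - nu'|)//.
    apply: norm_le_coord => // i; rewrite -linearB mxE; exact: coord_le_norm.
  by rewrite (le_trans nuL)// ler_wpM2l ?norm_le_norm2// divr_ge0// ltW.
split=> [eps eps0|].
  by split=> [b0|w w0]; [exact: V_concave | exact: V_convex].
(* The gradient is kept as [potential_sums] of a minimizer, the form in which [minimizer_lipschitz]
   bounds its variation. *)
have gradP eps wnn w : 0 < eps -> nonneg w ->
    ediff (fun w' => V P eps w' (b wnn)) w /\
    forall nu, minimizer P eps w (b wnn) nu ->
      egrad (fun w' => V P eps w' (b wnn)) w = potential_sums P nu.
  move=> eps0 w0; have [nu mnu] := minE eps w wnn eps0 w0.
  split=> [|{mnu}nu mnu];
      have [d [C [d0 C0 VP]]] := V_quadratic_approx eps0 w0 mnu.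
    split.
      near=> w'; have /VP[] // : `|w' - w| < d.
      by rewrite distrC; near: w'; exact: (@cvgr_dist_lt _ _ _ (nbhs w) _ id w _ d d0).
    apply: (quadratic_approx_diff d0 C0 _).1 => w' /VP[_]; exact.
  apply/matrixP => i j; rewrite ord1 mxE -dotp_delta.
  by apply: (quadratic_approx_diff d0 C0 _).2 => w' /VP[_]; exact.
split=> [eps wnn eps0|eps w wnn eps0 w0].
  split=> [w w0|].
    have [dV gV] := gradP eps wnn w eps0 w0; split=> //.
    have [nu mnu] := minE eps w wnn eps0 w0.
    by rewrite (gV _ mnu) (minimizer_ystar eps0 w0 mnu) (minimizer_Phi eps0 w0 mnu).
  have [C C0 lip] := minimizer_lipschitz P xsy (g wnn).
  exists (r%:R * (C / eps)) => w w' w0 w'0.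
  have [nu mnu] := minE eps w wnn eps0 w0.
  have [nu' mnu'] := minE eps w' wnn eps0 w'0.
  rewrite ((gradP eps wnn w eps0 w0).2 _ mnu) ((gradP eps wnn w' eps0 w'0).2 _ mnu').
  have [_ GL] := lip _ _ _ _ _ eps0 w0 w'0 mnu mnu'.
  rewrite (le_trans (norm2_le_norm _))// -mulrA ler_wpM2l//.
  by rewrite (le_trans GL)// ler_wpM2l ?norm_le_norm2// divr_ge0// ltW.
split=> [i _|gs]; first by apply: partial_subdiff_dual => //; exact: feas.
(* The neural output enters only the hard-constraint and potential rows; the constants at [g = 0]
   make up the rest. *)
have bE : b = fun wnn => col_mx (ac_g P) (col_mx (col_mx (aphi_g P) 0)
    (0 : 'M[R]_(ny + ny, ng))) *m g wnn + bvec P xsy 0.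
  apply/funext => w'; rewrite /b /bvec !mul_col_mx !add_col_mx !mul0mx !mulmx0 !add0r !addr0.
  by congr (col_mx _ (col_mx (col_mx _ _) _)); rewrite addrAC addrC.
have bs : smooth b by rewrite bE; exact: smooth_affine.
split=> // _ [v vV <-]; exact: reg_subdiff_comp (bs.1 wnn) vV.
Unshelve. all: by end_near. Qed.
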